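(* Let $\theta_X$ be a formigram over a nonempty finite set $X$. Then for any $\varepsilon\ge0$, $$\mathrm{Reeb}(S_\varepsilon\theta_X)=S_\varepsilon\,\mathrm{Reeb}(\theta_X).$$
   Context: A subpartition of $X$ is a partition $P$ of a (possibly empty) subset of $X$; its elements are blocks and $\bigcup P$ is its underlying set. $\mathrm{SubPart}(X)$ is the lattice of all subpartitions of $X$, ordered by $P\le Q$ iff every block of $P$ is contained in some block of $Q$; $\vee$ is the finest common coarsening. A formigram over $X$ is a map $\theta_X:\mathbb{R}\to\mathrm{SubPart}(X)$ such that (a) there is a locally finite set $C\subset\mathbb{R}$ such that $\theta_X$ is constant on each connected component of $\mathbb{R}\setminus C$ and for every $c\in C$ there is $r_c>0$ with $\theta_X(c-\varepsilon)\le\theta_X(c)\ge\theta_X(c+\varepsilon)$ for all $\varepsilon\in[0,r_c)$; (b) for each $x\in X$ there is a (nonempty) closed interval $I_x\subset\mathbb{R}$ with $x\in\bigcup\theta_X(t)$ iff $t\in I_x$. $\mathbf{Int}$ is the poset (category) of nonempty bounded closed real intervals ordered by inclusion; $I^\varepsilon=[b-\varepsilon,d+\varepsilon]$ for $I=[b,d]$. A formigram is also regarded as the functor $\mathbf{Int}\to\mathrm{SubPart}(X)$, $I\mapsto\bigvee\{\theta_X(t):t\in I\}$; as a map on $\mathbb{R}$ it is recovered by $t\mapsto$ the value at $[t,t]$. For a functor $F:\mathbf{Int}\to\mathbf{C}$ to any category, the $\varepsilon$-smoothing $S_\varepsilon F:\mathbf{Int}\to\mathbf{C}$ is the functor $I\mapsto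 F(I^\varepsilon)$, $(I\subset J)\mapsto F(I^\varepsilon\subset J^\varepsilon)$. For a formigram this gives the formigram $S_\varepsilon\theta_X$ with $(S_\varepsilon\theta_X)(t)=\bigvee\{\theta_X(s):s\in[t-\varepsilon,t+\varepsilon]\}$. For a formigram $\theta$, $\mathrm{Reeb}(\theta):\mathbf{Int}\to\mathbf{set}$ is the functor sending $I$ to the set of blocks of $\bigvee\{\theta(t):t\in I\}$ and $I\subset J$ to the map sending a block to the unique block containing it. *)

(* Defs.v *)
From HB Require Import structures.
From mathcomp Require Import all_boot all_order all_algebra.
From mathcomp Require Import all_classical all_reals all_analysis.
From mathcomp Require Import lra.
Set Implicit Arguments.
Unset Strict Implicit.
Unset Printing Implicit Defensive.
Import Order.TTheory GRing.Theory Num.Theory numFieldNormedType.Exports.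
Local Open Scope classical_set_scope.
Local Open Scope ring_scope.

Section SubPart.
Variable X : finType.

Record subpart := SubPart {
  blocks :> {set {set X}};
  _ : finset.partition blocks (finset.cover blocks) }.

HB.instance Definition _ := [isSub for blocks].
HB.instance Definition _ := [Finite of subpart by <:].

Implicit Types P Q S : subpart.

Lemma subpartP P : finset.partition P (finset.cover P).
Proof. exact: valP P. Qed.

Lemma subpart_trivI P : finset.trivIset P.
Proof. by have /and3P[] := subpartP P. Qed.

Lemma block_neq0 P (B : {set X}) : B \in blocks P -> exists x, x \in B.
Proof.
move=> BP; apply/finset.set0Pn; apply/eqP => B0.
by have /and3P[_ _] := subpartP P; rewrite -B0 BP.
Qed.

Lemma block_eq P (B C : {set X}) x :
  B \in blocks P -> C \in blocks P -> x \in B -> x \in C -> B = C.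
Proof.
move=> BP CP xB xC.
by rewrite -(finset.def_pblock (subpart_trivI P) BP xB)
  -(finset.def_pblock (subpart_trivI P) CP xC).
Qed.

Definition le_subpart : rel subpart := fun P Q =>
  [forall B in blocks P, exists C in blocks Q, B \subset C].

Lemma le_subpartP P Q :
  reflect (forall B, B \in blocks P -> exists2 C, C \in blocks Q & B \subset C)
          (le_subpart P Q).
Proof.
apply: (iffP forall_inP) => H B BP; first by have /exists_inP := H B BP.
by apply/exists_inP; exact: H.
Qed.

Lemma le_subpart_refl : reflexive le_subpart.
Proof. by move=> P; apply/le_subpartP => B BP; exists B. Qed.

Lemma le_subpart_trans : transitive le_subpart.
Proof.
move=> Q P S /le_subpartP PQ /le_subpartP QS; apply/le_subpartP => B /PQ[C CQ BC].
by have [D DS CD] := QS _ CQ; exists D => //; exact: fintype.subset_trans BC CD.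
Qed.

Lemma le_subpart_anti : antisymmetric le_subpart.
Proof.
move=> P Q /andP[/le_subpartP PQ /le_subpartP QP].
have sub (S T : subpart) :
    (forall B, B \in blocks S -> exists2 C, C \in blocks T & B \subset C) ->
    (forall B, B \in blocks T -> exists2 C, C \in blocks S & B \subset C) ->
    forall B, B \in blocks S -> B \in blocks T.
  move=> ST TS B BS; have [C CT BC] := ST _ BS; have [D DS CD] := TS _ CT.
  have [x xB] := block_neq0 BS.
  have BD : B = D.
    by apply: (block_eq BS DS xB); apply: (fintype.subsetP CD); apply: (fintype.subsetP BC).
  suff -> : B = C by [].
  by apply/eqP; rewrite finset.eqEsubset BC /= BD.
apply: val_inj; apply/finset.setP => B; apply/idP/idP; exact: sub.
Qed.

HB.instance Definition _ := Order.Le_isPOrder.Build Order.default_display subpart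
  le_subpart_refl le_subpart_anti le_subpart_trans.

Lemma lePP P Q :
  reflect (forall B, B \in blocks P -> exists2 C, C \in blocks Q & B \subset C)
          (P <= Q)%O.
Proof. exact: le_subpartP. Qed.

Definition share P Q : rel X := fun x y =>
  [exists B in blocks P :|: blocks Q, (x \in B) && (y \in B)].

(* Finest common coarsening: x and y are in the same block iff they are joined
   by a chain of elements, any two consecutive ones sharing a block of P or Q. *)
Definition join_blocks P Q : {set {set X}} :=
  finset.equivalence_partition (connect (share P Q)) (finset.cover P :|: finset.cover Q).

Lemma share_sym P Q : symmetric (share P Q).
Proof.
by move=> x y; apply/exists_inP/exists_inP => -[B BPQ /andP[a b]];
  exists B => //; rewrite a b.
Qed.

Lemma join_blocks_partition P Q :
  finset.partition (join_blocks P Q) (finset.cover P :|: finset.cover Q).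
Proof.
apply: finset.equivalence_partitionP => x y z _ _ _; split=> // xy.
apply: same_connect => //; exact/sym_connect_sym/share_sym.
Qed.

Lemma join_subpart_subproof P Q :
  finset.partition (join_blocks P Q) (finset.cover (join_blocks P Q)).
Proof. by rewrite (finset.cover_partition (join_blocks_partition P Q)) join_blocks_partition. Qed.

Definition join_subpart P Q := SubPart (join_subpart_subproof P Q).


Lemma cover_join_subpart P Q :
  finset.cover (join_subpart P Q) = finset.cover P :|: finset.cover Q.
Proof. exact: finset.cover_partition (join_blocks_partition P Q). Qed.

Lemma join_subpart_ub P Q S :
  blocks S \subset blocks P :|: blocks Q -> (S <= join_subpart P Q)%O.
Proof.
move=> /fintype.subsetP SPQ; apply/lePP => B BS; have [x xB] := block_neq0 BS.
have BPQ := SPQ _ BS.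
have cov y : y \in B -> y \in finset.cover P :|: finset.cover Q.
  move=> yB; move: BPQ; rewrite !finset.in_setU => /orP[] BP; apply/orP;
    [left|right]; by apply/finset.bigcupP; exists B.
exists [set y in finset.cover P :|: finset.cover Q | connect (share P Q) x y]%SET.
  by apply/finset.imsetP; exists x => //; exact: cov.
apply/fintype.subsetP => y yB; rewrite finset.inE cov //=; apply: connect1.
by apply/exists_inP; exists B => //; rewrite xB.
Qed.

Lemma join_subpart_lub P Q S : (join_subpart P Q <= S)%O = (P <= S)%O && (Q <= S)%O.
Proof.
apply/idP/andP => [PQS|[/lePP PS /lePP QS]].
  by split; apply: le_trans PQS; apply: join_subpart_ub;
    rewrite ?finset.subsetUl ?finset.subsetUr.
have PQS B : B \in blocks P :|: blocks Q -> exists2 C, C \in blocks S & B \subset C.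
  by rewrite finset.in_setU => /orP[]; [exact: PS|exact: QS].
apply/lePP => D /finset.imsetP[x xPQ ->].
have [B BPQ xB] : exists2 B, B \in blocks P :|: blocks Q & x \in B.
  move: xPQ; rewrite finset.in_setU => /orP[] /finset.bigcupP[B BP xB];
    by exists B => //; rewrite finset.in_setU BP ?orbT.
have [C CS BC] := PQS _ BPQ; exists C => //; apply/fintype.subsetP => y.
rewrite finset.inE => /andP[_ xy].
have clC : fingraph.closed (share P Q) (mem C).
  apply: intro_closed; first exact/sym_connect_sym/share_sym.
  move=> u v /exists_inP[E EPQ /andP[uE vE]] uC.
  have [F FS EF] := PQS _ EPQ.
  by rewrite (block_eq CS FS uC (fintype.subsetP EF _ uE)) (fintype.subsetP EF).
have <- : (x \in C) = (y \in C) := closed_connect clC xy.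
exact: (fintype.subsetP BC).
Qed.

HB.instance Definition _ :=
  Order.POrder_isJoinSemilattice.Build Order.default_display subpart join_subpart_lub.

Lemma bot_subpart_subproof :
  finset.partition (@finset.set0 {set X}) (finset.cover finset.set0).
Proof. by rewrite /finset.partition eqxx finset.inE andbT; apply/finset.trivIsetP => A B; rewrite finset.inE. Qed.

Definition bot_subpart := SubPart bot_subpart_subproof.

Lemma bot_subpart_le P : (bot_subpart <= P)%O.
Proof. by apply/lePP => B; rewrite finset.inE. Qed.

HB.instance Definition _ :=
  Order.hasBottom.Build Order.default_display subpart bot_subpart_le.

Lemma cover_joins (A : {pred subpart}) x :
  x \in finset.cover (\join_(P in A) P)%O <-> exists2 P, P \in A & x \in finset.cover P.
Proof.
have -> : finset.cover (\join_(P in A) P)%O = \big[@finset.setU X/finset.set0]_(P in A) finset.cover P.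
  apply: (big_morph (fun P => finset.cover (blocks P))) => [P Q|].
    exact: cover_join_subpart.
  by rewrite /finset.cover /= finset.big_set0.
by split=> [/finset.bigcupP[P]|[P PA xP]]; [exists P|apply/finset.bigcupP; exists P].
Qed.

Definition blockset P : set {set X} := [set` blocks P].

Lemma block_ub P Q (PQ : (P <= Q)%O) (B : blockset P) :
  exists C : blockset Q, val B \subset val C.
Proof.
have [C CQ BC] := elimT (lePP P Q) PQ _ (set_mem (valP B)).
by exists (exist _ C (mem_set CQ)).
Qed.

Definition block_map P Q (PQ : (P <= Q)%O) (B : blockset P) : blockset Q :=
  projT1 (cid (block_ub PQ B)).

Lemma block_map_sub P Q (PQ : (P <= Q)%O) (B : blockset P) :
  val B \subset val (block_map PQ B).
Proof. exact: projT2 (cid (block_ub PQ B)). Qed.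

Lemma block_map_unique P Q (PQ : (P <= Q)%O) (B : blockset P) (C : blockset Q) :
  val B \subset val C -> C = block_map PQ B.
Proof.
move=> BC; have [x xB] := block_neq0 (set_mem (valP B)).
apply: val_inj; apply: (block_eq (set_mem (valP C)) (set_mem (valP (block_map PQ B))) (x := x)).
  exact: (fintype.subsetP BC).
exact: (fintype.subsetP (block_map_sub PQ B)).
Qed.

End SubPart.

Section Categories.

Record category := Category {
  obj :> Type;
  hom : obj -> obj -> Type;
  idm : forall a, hom a a;
  comp : forall a b c, hom b c -> hom a b -> hom a c;
  _ : forall a b (f : hom a b), comp (idm b) f = f;
  _ : forall a b (f : hom a b), comp f (idm a) = f;
  _ : forall a b c d (h : hom c d) (g : hom b c) (f : hom a b),
        comp h (comp g f) = comp (comp h g) f }.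

Record functor (C D : category) := Functor {
  fobj :> C -> D;
  fmap : forall a b : C, hom a b -> hom (fobj a) (fobj b);
  fmap_idm : forall a : C, fmap (idm a) = idm (fobj a);
  fmap_comp : forall (a b c : C) (g : hom b c) (f : hom a b),
        fmap (comp g f) = comp (fmap g) (fmap f) }.

Definition poset_cat (T : Type) (le : T -> T -> Prop) (le_refl : forall a, le a a)
    (le_trans : forall a b c, le b c -> le a b -> le a c) : category :=
  @Category T le le_refl le_trans
    (fun _ _ _ => Prop_irrelevance _ _) (fun _ _ _ => Prop_irrelevance _ _)
    (fun _ _ _ _ _ _ _ => Prop_irrelevance _ _).

Lemma poset_hom_irr T le le_refl le_trans (a b : @poset_cat T le le_refl le_trans)
  (f g : hom a b) : f = g.
Proof. exact: (@Prop_irrelevance (le a b)). Qed.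

(* A set is given as a subset of an ambient type, so that equality of objects is
   equality of the sets themselves, rather than equality of types. *)
Definition set_cat : category :=
  @Category {T : Type & set T} (fun A B => projT2 A -> projT2 B)
    (fun A => id) (fun A B C g f => g \o f)
    (fun _ _ _ => erefl) (fun _ _ _ => erefl) (fun _ _ _ _ _ _ _ => erefl).

End Categories.

Definition subpart_cat (X : finType) : category :=
  @poset_cat (subpart X) (fun P Q => (P <= Q)%O)
    (fun P => le_refl P) (fun P Q S QS PQ => le_trans PQ QS).

Section Int.
Variable R : realType.

Record cint := CInt { lo : R; hi : R; _ : lo <= hi }.

Definition cint_set (I : cint) : set R := [set` `[lo I, hi I]].

Definition int_cat : category :=
  @poset_cat cint (fun I J => cint_set I `<=` cint_set J)
    (fun I => @subset_refl _ (cint_set I)) (fun I J K JK IJ => subset_trans IJ JK).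

Definition point (t : R) : cint := CInt (lexx t).

Lemma cint_subP (I J : cint) :
  cint_set I `<=` cint_set J <-> lo J <= lo I /\ hi I <= hi J.
Proof.
have le := (let: CInt _ _ h as I0 := I return lo I0 <= hi I0 in h).
split=> [IJ|[l h] t].
  have /andP[l _] : lo J <= lo I <= hi J.
    by have := IJ (lo I); rewrite /cint_set /= !in_itv /= lexx le; exact.
  have /andP[_ h] : lo J <= hi I <= hi J.
    by have := IJ (hi I); rewrite /cint_set /= !in_itv /= lexx le; exact.
  by [].
rewrite /cint_set /= !in_itv /= => /andP[a b].
by rewrite (le_trans l a) (le_trans b h).
Qed.

Lemma thicken_subproof (eps : R) (I : cint) :
  0 <= eps -> lo I - eps <= hi I + eps.
Proof.
case: I => b d bd e0 /=; rewrite lerBlDr -addrA.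
by apply: le_trans bd _; rewrite lerDl addr_ge0.
Qed.

Definition thicken (eps : R) (eps0 : 0 <= eps) (I : cint) : cint :=
  CInt (thicken_subproof I eps0).

Lemma thicken_sub (eps : R) (eps0 : 0 <= eps) (I J : cint) :
  cint_set I `<=` cint_set J ->
  cint_set (thicken eps0 I) `<=` cint_set (thicken eps0 J).
Proof. by move=> /cint_subP[l h]; apply/cint_subP; rewrite /= lerB // lerD. Qed.

Definition smoothing (C : category) (eps : R) (eps0 : 0 <= eps)
    (F : functor int_cat C) : functor int_cat C.
Proof.
refine (@Functor int_cat C (fun I => F (thicken eps0 I))
  (fun I J IJ => fmap F (@thicken_sub eps eps0 I J IJ : @hom int_cat _ _)) _ _).
- move=> I; rewrite -(fmap_idm F (thicken eps0 I)); congr (fmap F _).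
  exact: poset_hom_irr.
- move=> I J K JK IJ; rewrite -(fmap_comp F); congr (fmap F _).
  exact: poset_hom_irr.
Defined.

End Int.

Definition locally_finite (T : topologicalType) (C : set T) :=
  forall x : T, exists2 U, nbhs x U & finite_set (C `&` U).

Section Formigram.
Variables (R : realType) (X : finType).

(* The life interval of x is closed but may be unbounded. *)
Record formigram := Formigram {
  formigram_fun :> R -> subpart X;
  formigram_tame : exists C : set R,
    [/\ locally_finite C,
        forall t s, connected_component (~` C) t s ->
          formigram_fun s = formigram_fun t
      & forall c, C c -> exists2 r, 0 < r & forall e, 0 <= e < r ->
          (formigram_fun (c - e) <= formigram_fun c)%O /\
          (formigram_fun (c + e) <= formigram_fun c)%O];
  formigram_life : forall x : X, exists I : set R,
    [/\ I !=set0, closed I, is_interval I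
      & forall t, x \in finset.cover (formigram_fun t) <-> I t] }.

Definition join_over (theta : R -> subpart X) (I : set R) : subpart X :=
  (\join_(P in theta @` I) P)%O.

Lemma join_over_ub theta (I : set R) t : I t -> (theta t <= join_over theta I)%O.
Proof. by move=> It; apply: (joins_sup (j := theta t)); apply: mem_set; exists t. Qed.

Lemma join_over_lub theta (I : set R) Q :
  (join_over theta I <= Q)%O <-> forall t, I t -> (theta t <= Q)%O.
Proof.
split=> [IQ t It|IQ]; first exact: le_trans (join_over_ub theta It) IQ.
by apply/joinsP => P /set_mem[t It <-]; exact: IQ.
Qed.

Lemma join_over_mono theta (I J : set R) :
  I `<=` J -> (join_over theta I <= join_over theta J)%O.
Proof. by move=> IJ; apply/join_over_lub => t /IJ; exact: join_over_ub. Qed.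

Lemma cover_join_over theta (I : set R) x :
  x \in finset.cover (join_over theta I) <-> exists2 t, I t & x \in finset.cover (theta t).
Proof.
rewrite /join_over cover_joins; split=> [[P /set_mem[t It <-] xP]|[t It xt]].
  by exists t.
by exists (theta t) => //; apply: mem_set; exists t.
Qed.

Definition formigram_functor (theta : formigram) : functor (int_cat R) (subpart_cat X) :=
  @Functor (int_cat R) (subpart_cat X) (fun I => join_over theta (cint_set I))
    (fun I J IJ => join_over_mono theta IJ)
    (fun _ => poset_hom_irr _ _) (fun _ _ _ _ _ => poset_hom_irr _ _).

Lemma tame_const (theta : R -> subpart X) (C : set R) s t :
  (forall t s, connected_component (~` C) t s -> theta s = theta t) ->
  s <= t -> (forall u, s <= u <= t -> ~ C u) -> theta s = theta t.
Proof.
move=> cst st nC; apply: cst.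
apply: (connected_component_max (B := [set` `[s, t]])).
- by rewrite /= in_itv /= lexx st.
- by move=> u; rewrite /= in_itv /=; exact: nC.
- exact/connected_intervalP/interval_is_interval.
- by rewrite /= in_itv /= lexx st.
Qed.

Lemma tame_local (theta : formigram) c :
  exists2 r, 0 < r & forall u, c - r < u < c + r -> (theta u <= theta c)%O.
Proof.
have [C [lf cst loc]] := formigram_tame theta.
have [Cc|nCc] := pselect (C c).
  have [r r0 H] := loc c Cc; exists r => // u /andP[u1 u2].
  have [uc|cu] := leP u c.
    have [+ _] := H (c - u) (ltac:(by rewrite subr_ge0 uc /= ltrBlDr -ltrBlDl)).
    by rewrite subKr.
  have [_] := H (u - c) (ltac:(by rewrite subr_ge0 ltW //= ltrBlDr addrC)).
  by rewrite addrC subrK.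
have [U cU finU] := lf c.
have cV : nbhs c (U `&` ~` (C `&` U)).
  apply: filterI => //; apply: open_nbhs_nbhs; split.
    apply: closed_openC; apply: compact_closed; first exact: Rhausdorff.
    exact: finite_compact.
  by move=> [].
have [r /= r0 rV] := cV; exists r => // u /andP[u1 u2].
have nC v : c - r < v < c + r -> ~ C v.
  move=> /andP[v1 v2] Cv.
  have [Uv nCUv] : (U `&` ~` (C `&` U)) v.
    by apply: rV; rewrite /= ltr_distlC v1 v2.
  exact: nCUv.
have c1 : c - r < c by rewrite ltrBlDr ltrDl.
have c2 : c < c + r by rewrite ltrDl.
suff -> : theta u = theta c by [].
have [uc|/ltW cu] := leP u c; [|symmetry];
  apply: (tame_const cst) => // v /andP[v1 v2]; apply: nC.
  by rewrite (lt_le_trans u1 v1) (le_lt_trans v2 c2).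
by rewrite (lt_le_trans c1 v1) (le_lt_trans v2 u2).
Qed.

Section Smoothing.
Variables (eps : R) (eps0 : 0 <= eps) (theta : formigram).

Definition smoothing_fun (t : R) : subpart X :=
  smoothing eps0 (formigram_functor theta) (point t).

Lemma smoothing_funE t :
  smoothing_fun t = join_over theta [set` `[t - eps, t + eps]].
Proof. by []. Qed.

Lemma smoothing_fun_ub t u : t - eps <= u <= t + eps -> (theta u <= smoothing_fun t)%O.
Proof. by move=> tu; apply: join_over_ub; rewrite /cint_set /= in_itv. Qed.

Lemma smoothing_fun_lub t Q :
  (forall u, t - eps <= u <= t + eps -> (theta u <= Q)%O) -> (smoothing_fun t <= Q)%O.
Proof. by move=> H; apply/join_over_lub => u; rewrite /cint_set /= in_itv; exact: H. Qed.

Lemma smoothing_tame : exists C : set R,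
    [/\ locally_finite C,
        forall t s, connected_component (~` C) t s ->
          smoothing_fun s = smoothing_fun t
      & forall c, C c -> exists2 r, 0 < r & forall e, 0 <= e < r ->
          (smoothing_fun (c - e) <= smoothing_fun c)%O /\
          (smoothing_fun (c + e) <= smoothing_fun c)%O].
Proof.
have [C [lf cst _]] := formigram_tame theta.
have eps2 : - eps <= eps by rewrite ge0_cp.
exists [set t | C (t - eps) \/ C (t + eps)]; split.
- move=> x; have [U1 xU1 fin1] := lf (x - eps); have [U2 xU2 fin2] := lf (x + eps).
  exists ([set t | U1 (t - eps)] `&` [set t | U2 (t + eps)]).
    apply: filterI.
      have : (fun t : R => t - eps) t @[t --> x] --> x - eps.
        by apply: cvgB; [exact: cvg_id|exact: cvg_cst].
      by move=> /(_ _ xU1).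
    have : (fun t : R => t + eps) t @[t --> x] --> x + eps.
      by apply: cvgD; [exact: cvg_id|exact: cvg_cst].
    by move=> /(_ _ xU2).
  apply: (@sub_finite_set _ _ ((fun t => t + eps) @` (C `&` U1) `|`
                               (fun t => t - eps) @` (C `&` U2))).
    move=> t [[C1|C2] [t1 t2]].
      by left; exists (t - eps); [split|rewrite subrK].
    by right; exists (t + eps); [split|rewrite addrK].
  by rewrite finite_setU; split; exact: finite_image.
- move=> t s [B [Bt BC cB] Bs].
  wlog ts : t s Bt Bs / t <= s.
    by move=> H; have [|/ltW] := leP t s; [exact: H|move=> st; symmetry; exact: H].
  have nC u : t <= u <= s -> ~ C (u - eps) /\ ~ C (u + eps).
    move=> tus; have /connected_intervalP iB := cB.
    by have /not_orP := BC _ (iB _ _ Bt Bs _ tus).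
  apply/le_anti/andP; split; apply: smoothing_fun_lub => u /andP[u1 u2].
    have [ut|tu] := leP u (t + eps).
      by apply: smoothing_fun_ub; rewrite ut (le_trans _ u1) // lerB.
    have -> : theta u = theta (t + eps).
      symmetry; apply: (tame_const cst); first exact: ltW.
      move=> v /andP[v1 v2].
      have [|_] := nC (v - eps); last by rewrite subrK.
      by rewrite lerBrDr v1 lerBlDr (le_trans v2).
    by apply: smoothing_fun_ub; rewrite lexx lerD2l eps2.
  have [su|us] := leP (s - eps) u.
    by apply: smoothing_fun_ub; rewrite su (le_trans u2) // lerD.
  have -> : theta u = theta (s - eps).
    apply: (tame_const cst); first exact: ltW.
    move=> v /andP[v1 v2].
    have [|+ _] := nC (v + eps); last by rewrite addrK.
    by rewrite -lerBlDr (le_trans u1 v1) -lerBrDr.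
  by apply: smoothing_fun_ub; rewrite lexx lerD2l eps2.
- move=> c _.
  have [r1 r10 H1] := tame_local theta (c - eps).
  have [r2 r20 H2] := tame_local theta (c + eps).
  exists (Num.min r1 r2); first by rewrite lt_min r10 r20.
  move=> e /andP[e0]; rewrite lt_min => /andP[er1 er2].
  have lo : (theta (c - eps) <= smoothing_fun c)%O.
    by apply: smoothing_fun_ub; rewrite lexx lerD2l eps2.
  have hi : (theta (c + eps) <= smoothing_fun c)%O.
    by apply: smoothing_fun_ub; rewrite lexx lerD2l eps2.
  split; apply: smoothing_fun_lub => u /andP[u1 u2].
    have [cu|uc] := leP (c - eps) u.
      by apply: smoothing_fun_ub; rewrite cu; lra.
    by apply: le_trans lo; apply: H1; apply/andP; split; lra.
  have [cu|uc] := leP u (c + eps).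
    by apply: smoothing_fun_ub; rewrite cu andbT; lra.
  by apply: le_trans hi; apply: H2; apply/andP; split; lra.
Qed.

Lemma smoothing_life x : exists I : set R,
    [/\ I !=set0, closed I, is_interval I
      & forall t, x \in finset.cover (smoothing_fun t) <-> I t].
Proof.
have [I [[a Ia] clI itvI HI]] := formigram_life theta x.
have e0 := eps0.
pose J : set R := [set t | exists2 u, I u & t - eps <= u <= t + eps].
have HJ t : x \in finset.cover (smoothing_fun t) <-> J t.
  rewrite smoothing_funE cover_join_over; split=> -[u]; rewrite ?HI /= ?in_itv /=.
    by move=> tu Iu; exists u.
  by move=> Iu tu; exists u; rewrite ?HI //= in_itv.
exists J; split=> //.
- by exists a, a => //; apply/andP; split; lra.
- rewrite -openC openE => t nJt.
  have nI u : t - eps <= u <= t + eps -> ~ I u by move=> tu Iu; apply: nJt; exists u.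
  have opI : open (~` I) by exact: closed_openC.
  have nbh v : ~ I v -> exists2 r, 0 < r & forall u, v - r < u < v + r -> ~ I u.
    move=> nIv; have [r /= r0 rI] := open_nbhs_nbhs (conj opI nIv).
    by exists r => // u vu; apply: rI; rewrite /= ltr_distlC.
  have [|r1 r10 H1] := nbh (t - eps); first by apply: nI; lra.
  have [|r2 r20 H2] := nbh (t + eps); first by apply: nI; lra.
  exists (Num.min r1 r2) => /=; first by rewrite lt_min r10 r20.
  move=> s /=; rewrite lt_min !ltr_distlC => /andP[/andP[s1 s2] /andP[s3 s4]].
  move=> [u Iu /andP[u1 u2]].
  have [cu|uc] := leP (t - eps) u; last by apply: (H1 u) => //; apply/andP; split; lra.
  have [uc|uc] := leP u (t + eps); first by apply: (nI u) => //; rewrite cu.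
  by apply: (H2 u) => //; apply/andP; split; lra.
- move=> s t [u Iu /andP[u1 u2]] [v Iv /andP[v1 v2]] w /andP[sw wt].
  have [a1|a1] := leP u (w + eps); last first.
    by move: a1 u2 sw => *; exfalso; lra.
  have [a2|a2] := leP (w - eps) u; first by exists u => //; rewrite a2.
  have [a3|a3] := leP v (w + eps).
    by exists v => //; rewrite a3 andbT; lra.
  by exists (w + eps); [apply: (itvI u v) => //; apply/andP; split; lra|apply/andP; split; lra].
Qed.

Definition formigram_smoothing : formigram :=
  Formigram smoothing_tame smoothing_life.

End Smoothing.

Definition Reeb (theta : formigram) : functor (int_cat R) set_cat.
Proof.
refine (@Functor (int_cat R) set_cat
  (fun I => existT _ {set X} (blockset (join_over theta (cint_set I))))
  (fun I J IJ => block_map (join_over_mono theta IJ)) _ _).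
- by move=> I; apply/funext => B; symmetry; apply: block_map_unique.
- move=> I J K JK IJ; apply/funext => B; symmetry; apply: block_map_unique.
  exact: fintype.subset_trans (block_map_sub _ _) (block_map_sub _ _).
Defined.

End Formigram.

(* Main.v *)
Require Import Defs.
From mathcomp Require Import all_boot all_order all_algebra.
From mathcomp Require Import all_classical all_reals all_analysis.
From mathcomp Require Import lra.
Import Order.TTheory GRing.Theory Num.Theory.
Local Open Scope ring_scope.

(** The interval [I^eps] is the union of the intervals [[t - eps, t + eps]] for
    [t] in [I], so joining [S_eps theta] over [I] is joining [theta] over
    [I^eps].  Both functors arise from a monotone map into subpartitions by
    taking blocks, and these two monotone maps are equal. *)

Lemma in_cint_set (R : realType) (I : cint R) (t : R) :
  cint_set I t <-> lo I <= t <= hi I.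
Proof. by rewrite /cint_set /= in_itv. Qed.

Lemma join_over_smoothing_fun (R : realType) (X : finType)
    (theta : formigram R X) (eps : R) (eps_ge0 : 0 <= eps) (I : cint R) :
  join_over (smoothing_fun eps_ge0 theta) (cint_set I) =
  join_over theta (cint_set (thicken eps_ge0 I)).
Proof.
have lohi : lo I <= hi I by case: I.
apply/le_anti/andP; split; apply/join_over_lub => t /in_cint_set /andP[It tI].
  apply: smoothing_fun_lub => s /andP[ts st]; apply: join_over_ub.
  by apply/in_cint_set => /=; apply/andP; split; lra.
move: It tI => /= It tI.
(* The witness [u] is the point of [I] nearest to [t]: [t] itself or an endpoint, within [eps]
   because [t] lies in the thickened interval. *)
have [u /andP[Iu uI] /andP[ut tu]] :
    exists2 u, lo I <= u <= hi I & u - eps <= t <= u + eps.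
  have [tlo|lot] := ltP t (lo I).
    by exists (lo I); apply/andP; split; lra.
  have [hit|thi] := ltP (hi I) t.
    by exists (hi I); apply/andP; split; lra.
  by exists t; apply/andP; split; lra.
apply: (@le_trans _ _ (smoothing_fun eps_ge0 theta u)).
  by apply: smoothing_fun_ub; rewrite ut tu.
by apply: join_over_ub; apply/in_cint_set; rewrite Iu uI.
Qed.

(* Equality of functors is Leibniz equality of records, so the dependent
   fields are matched by substituting the equality of the underlying maps. *)
Lemma block_functor_eq (X : finType) (T : Type) (le : T -> T -> Prop)
    (le_refl : forall a, le a a)
    (le_trans : forall a b c, le b c -> le a b -> le a c)
    (P Q : T -> subpart X)
    (P_mono : forall a b, le a b -> (P a <= P b)%O)
    (Q_mono : forall a b, le a b -> (Q a <= Q b)%O)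
    (C := poset_cat le_refl le_trans)
    P_id P_comp Q_id Q_comp :
  P =1 Q ->
  @Functor C set_cat (fun a => existT _ {set X} (blockset (P a)))
    (fun a b ab => block_map (P_mono a b ab)) P_id P_comp =
  @Functor C set_cat (fun a => existT _ {set X} (blockset (Q a)))
    (fun a b ab => block_map (Q_mono a b ab)) Q_id Q_comp.
Proof.
move=> /funext PQ; move: Q_mono Q_id Q_comp; case: Q / PQ => Q_mono.
(* Only once the monotonicity proofs coincide do the functor laws on both sides have the same
   type. *)
case: Q_mono / (Prop_irrelevance P_mono Q_mono) => Q_id Q_comp.
by congr Functor; exact: Prop_irrelevance.
Qed.

Theorem propositionC5 (R : realType) (X : finType) (X_nonempty : (0 < #|X|)%N)
    (theta : formigram R X) (eps : R) (eps_ge0 : 0 <= eps) :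
  Reeb (formigram_smoothing eps_ge0 theta) = smoothing eps_ge0 (Reeb theta).
Proof.
(* Both sides unfold to this form by conversion; [thicken_sub] supplies the arrows of the
   smoothing. *)
apply: (@block_functor_eq X (cint R) _ _ _
  (fun I => join_over (smoothing_fun eps_ge0 theta) (cint_set I))
  (fun I => join_over theta (cint_set (thicken eps_ge0 I)))
  (fun I J IJ => join_over_mono _ IJ)
  (fun I J IJ => join_over_mono theta (thicken_sub (eps0 := eps_ge0) IJ))).
exact: join_over_smoothing_fun.
Qed.
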